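(* For every $d\ge 1$, the group $\mathbb{Z}^d$ is algebraically recurrent. More generally, if $(H_n)_{n\ge1}$ is a non-degenerate, Liouville, symmetric, decreasing sequence of random subsemigroups of $\mathbb{Z}^d$, then almost surely $H_n=\mathbb{Z}^d$ for all $n$.
   Context: For a countable group $G$ and a probability measure $\mu$ on $G$, a $\mu$-random walk is $X_n=\zeta_1\cdots\zeta_n$ with $\zeta_i$ i.i.d. of law $\mu$; $\mathcal{S}_n$ denotes the semigroup generated by $\{X_n,X_{n+1},\ldots\}$. $(G,\mu)$ is algebraically recurrent (AR) if for every $n$, $\mathcal{S}_n=G$ almost surely; $G$ is AR if $(G,\mu)$ is AR for every symmetric probability measure $\mu$ (i.e. $\mu(g)=\mu(g^{-1})$) whose support generates $G$ as a group. Let $\mathfrak{S}(G)$ be the set of subsemigroups of $G$, viewed as a subset of $\{0,1\}^G$ with the product topology (a compact standard Borel space). A decreasing sequence $(H_n)$ of $\mathfrak{S}(G)$-valued random variables ($H_{n+1}\subseteq H_n$) is: non-degenerate if almost surely $H_n$ generates $G$ as a group for all $n$; Liouville if its tail $\sigma$-algebra $\bigcap_n\sigma(H_n,H_{n+1},\ldots)$ is trivial; symmetric if for every $n$, $H_n$ and $H_n^{-1}=\{h^{-1}:h\in H_n\}$ have the same distribution on $\mathfrak{S}(G)$. *)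

(* Defs.v *)
From HB Require Import structures.
From mathcomp Require Import all_boot all_order all_algebra.
From mathcomp Require Import all_classical all_reals all_analysis.
Set Implicit Arguments. Unset Strict Implicit. Unset Printing Implicit Defensive.
Import Order.TTheory GRing.Theory Num.Theory.
Local Open Scope classical_set_scope.
Local Open Scope ring_scope.

Notation Zd d := 'rV[int]_d.

Definition is_subsemigroup (d : nat) (S : set (Zd d)) : Prop :=
  forall x y, S x -> S y -> S (x + y).

Definition is_subgroup (d : nat) (K : set (Zd d)) : Prop :=
  K 0 /\ (forall x y, K x -> K y -> K (x + y)) /\ (forall x, K x -> K (- x)).

Definition semigroup_gen (d : nat) (A : set (Zd d)) : set (Zd d) :=
  [set g | forall S, is_subsemigroup S -> A `<=` S -> S g].

Definition group_gen (d : nat) (A : set (Zd d)) : set (Zd d) :=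
  [set g | forall K, is_subgroup K -> A `<=` K -> K g].

Definition set_inv (d : nat) (S : set (Zd d)) : set (Zd d) := [set g | S (- g)].

(* Borel sigma-algebra of the product topology on {0,1}^G, i.e. the sigma-algebra
   on subsets of G generated by the evaluation maps S |-> (g \in S). *)
Definition cyl_sigma (d : nat) : set (set (set (Zd d))) :=
  <<s [set [set S : set (Zd d) | S g] | g in [set: Zd d]] >>.

Definition discrete_rv {dsp : measure_display} {Omega : measurableType dsp}
  (d : nat) (zeta : nat -> Omega -> Zd d) : Prop :=
  forall i g, measurable [set w | zeta i w = g].

Definition mutually_independent {dsp : measure_display} {Omega : measurableType dsp}
  {R : realType} (P : probability Omega R) (d : nat) (zeta : nat -> Omega -> Zd d) : Prop :=
  forall (s : seq nat) (gs : nat -> Zd d), uniq s ->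
    P (\bigcap_(i in [set` s]) [set w | zeta i w = gs i]) =
    (\prod_(i <- s) P [set w | zeta i w = gs i])%E.

Definition is_prob_on (R : realType) (d : nat) (mu : Zd d -> R) : Prop :=
  (forall g, 0 <= mu g) /\ (\esum_(g in [set: Zd d]) (mu g)%:E = 1)%E.

Definition symmetric_measure (R : realType) (d : nat) (mu : Zd d -> R) : Prop :=
  forall g, mu g = mu (- g).

Definition support (R : realType) (d : nat) (mu : Zd d -> R) : set (Zd d) :=
  [set g | mu g != 0].

(* X_n = zeta_0 + ... + zeta_{n-1} (i.e. zeta_1 ... zeta_n in the paper's indexing). *)
Definition rw_position (d : nat) {Omega : Type} (zeta : nat -> Omega -> Zd d)
  (n : nat) (w : Omega) : Zd d := \sum_(i < n) zeta i w.

Definition AR_measure (R : realType) (d : nat) (mu : Zd d -> R) : Prop :=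
  forall (dsp : measure_display) (Omega : measurableType dsp)
         (P : probability Omega R) (zeta : nat -> Omega -> Zd d),
    discrete_rv zeta ->
    mutually_independent P zeta ->
    (forall i g, P [set w | zeta i w = g] = (mu g)%:E) ->
    forall n : nat, (1 <= n)%N ->
      {ae P, forall w, semigroup_gen [set rw_position zeta m w | m in [set m | (n <= m)%N]]
                        = [set: Zd d]}.

Definition AR_group (d : nat) : Prop :=
  forall (R : realType) (mu : Zd d -> R),
    is_prob_on mu -> symmetric_measure mu -> group_gen (support mu) = [set: Zd d] ->
    AR_measure mu.

(* Each H n is a random variable with values in the subsemigroups of Z^d
   (measurable for the product sigma-algebra on {0,1}^G). *)
Definition random_subsemigroups {dsp : measure_display} {Omega : measurableType dsp}
  (d : nat) (H : nat -> Omega -> set (Zd d)) : Prop :=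
  (forall n w, is_subsemigroup (H n w)) /\
  (forall n g, measurable [set w | H n w g]).

Definition decreasing_semigroups {Omega : Type} (d : nat) (H : nat -> Omega -> set (Zd d)) : Prop :=
  forall n w, H n.+1 w `<=` H n w.

Definition non_degenerate {dsp : measure_display} {Omega : measurableType dsp}
  {R : realType} (P : probability Omega R) (d : nat) (H : nat -> Omega -> set (Zd d)) : Prop :=
  {ae P, forall w, forall n, group_gen (H n w) = [set: Zd d]}.

Definition future_sigma {Omega : Type} (d : nat) (H : nat -> Omega -> set (Zd d)) (n : nat)
  : set (set Omega) :=
  <<s [set A : set Omega | exists m g, (n <= m)%N /\ A = [set w | H m w g]] >>.

Definition liouville {dsp : measure_display} {Omega : measurableType dsp}
  {R : realType} (P : probability Omega R) (d : nat) (H : nat -> Omega -> set (Zd d)) : Prop :=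
  forall A : set Omega, (forall n, future_sigma H n A) -> P A = 0%E \/ P A = 1%E.

Definition symmetric_seq {dsp : measure_display} {Omega : measurableType dsp}
  {R : realType} (P : probability Omega R) (d : nat) (H : nat -> Omega -> set (Zd d)) : Prop :=
  forall n (B : set (set (Zd d))), @cyl_sigma d B ->
    P [set w | B (H n w)] = P [set w | B (set_inv (H n w))].

(* Main.v *)
(** For [w] in Z^d let [open_cone w] be the open cone of all [h] with [|h|_1 < <w, h>].
    The event that every [H n] meets [open_cone w] has probability 0 or 1, and by
    symmetry in law it has the same probability for [w] and for [- w]; hence almost
    surely these two events agree for all integer [w] at once.  This is dual to saying
    that the increasing union K of the dual cones of the [H n] in R^d has a symmetric
    closure.  A convex cone with symmetric closure is a linear subspace, so if K <> 0 it
    contains some [v] and [- v] with [v <> 0]; then some [H n] lies in the hyperplane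
    orthogonal to [v] and cannot generate Z^d.  Hence K = 0, that is, every [H n] is Z^d.

    For a random walk the 0-1 law is that of Hewitt and Savage: an exchangeable event has
    the same covariance with all far away copies of a cylinder event, hence with their
    averages, which tend to a constant in L^2. *)

Require Import Defs.
From HB Require Import structures.
From mathcomp Require Import all_boot all_order all_algebra.
From mathcomp Require Import all_classical all_reals all_analysis.
From mathcomp Require Import zify ring lra.
Set Implicit Arguments. Unset Strict Implicit. Unset Printing Implicit Defensive.
Import Order.TTheory GRing.Theory Num.Theory.
Local Open Scope classical_set_scope.
Local Open Scope ring_scope.

(** * Positive functionals *)

Section OrderUnit.
Context {V : zmodType} (s : V).

(** The condition under which [s] can be given the value 1 by a functional nonnegative on [N]: no
    strictly negative multiple of [s] may lie in [N]. *)
Definition proper_submonoid (N : set V) : Prop :=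
  [/\ N 0, (forall x y, N x -> N y -> N (x + y)) & forall k, ~ N (- (s *+ k.+1))].

Lemma proper_submonoid_mulrn N x n : proper_submonoid N -> N x -> N (x *+ n).
Proof.
move=> [N0 Nadd _] Nx; elim: n => [|n ih]; first by rewrite mulr0n.
by rewrite mulrS; exact: Nadd.
Qed.

(** A maximal proper submonoid is total: if it missed both [x] and [- x], adjoining either one would
    produce a negative multiple of [s], and a combination of the two relations cancels [x]. *)
Lemma proper_submonoid_extend M : proper_submonoid M ->
  exists T, [/\ proper_submonoid T, M `<=` T & forall x, T x \/ T (- x)].
Proof.
move=> Mp.
(* Taking the union with [M] makes the empty chain harmless: its union yields [M] itself. *)
pose P := [set N : set V | proper_submonoid (M `|` N)].
have [F FP totF|A [PA maxA]] := @Zorn_bigcup V P.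
  have [M0 Madd Mneg] := Mp.
  split; first by left.
  - move=> x y [Mx|[X FX Xx]] [My|[Y FY Yy]].
    + by left; exact: Madd.
    + have [_ add _] := FP _ FY.
      by have [|] := add x y (or_introl Mx) (or_intror Yy); [left|right; exists Y].
    + have [_ add _] := FP _ FX.
      by have [|] := add x y (or_intror Xx) (or_introl My); [left|right; exists X].
    + have [XY|YX] := totF _ _ FX FY.
      * have [_ add _] := FP _ FY.
        by have [|] := add x y (or_intror (XY _ Xx)) (or_intror Yy); [left|right; exists Y].
      * have [_ add _] := FP _ FX.
        by have [|] := add x y (or_intror Xx) (or_intror (YX _ Yy)); [left|right; exists X].
  - move=> k [Mk|[X FX Xk]]; first exact: (Mneg k).
    by have [_ _ neg] := FP _ FX; apply: (neg k); right.
exists (M `|` A); split=> [//|y My|]; first by left.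
set T := M `|` A; have Tp : proper_submonoid T by [].
have maxT N : T `<=` N -> proper_submonoid N -> N `<=` T.
  move=> TN Np x Nx; right; apply: contrapT => nAx.
  apply: (maxA N).
    split; first by apply: subset_trans TN => y; right.
    by move=> /(_ _ Nx).
  by rewrite /P /= (_ : M `|` N = N)//; apply/setUidPr => y My; apply: TN; left.
have [T0 Tadd Tneg] := Tp.
(* The submonoid generated by [T] and [x], closed under removing multiples of [x], strictly contains
   [T], so by maximality it is not proper. *)
have out x : ~ T x -> exists k a, T (- (s *+ k.+1) - x *+ a).
  move=> nTx; apply: contrapT => no; apply: nTx.
  apply: (maxT [set y | exists a, T (y - x *+ a)]).
  - by move=> y Ty; exists 0%N; rewrite mulr0n subr0.
  - split.
    + by exists 0%N; rewrite mulr0n subr0.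
    + move=> y z [a Ta] [b Tb]; exists (a + b)%N.
      by rewrite mulrnDr opprD addrACA; exact: Tadd.
    + by move=> k [a Ta]; apply: no; exists k, a.
  - by exists 1%N; rewrite mulr1n subrr.
move=> x; apply: contrapT => /not_orP[/out[k [a Ta]] /out[l [b Tb]]].
(* If [a = 0], the first relation alone contradicts properness. Otherwise [b] times the first plus
   [a] times the second cancels [x], and [a > 0] keeps the multiple of [s] strictly negative. *)
case: a => [|a] in Ta; first by apply: (Tneg k); rewrite mulr0n subr0 in Ta.
have := Tadd _ _ (proper_submonoid_mulrn b Tp Ta) (proper_submonoid_mulrn a.+1 Tp Tb).
rewrite !mulrnBl !mulNrn -!mulrnA (mulnC b) addrACA opprK addNr addr0.
rewrite -opprD -mulrnDr.
have -> : (k.+1 * b + l.+1 * a.+1)%N = (k.+1 * b + l.+1 * a.+1).-1.+1 by lia.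
exact: Tneg.
Qed.

(* A total submonoid cuts the rationals at each x; the functional is the real
   number of that cut. *)
Lemma order_unit_functional (R : realType) (M : set V) :
  proper_submonoid M -> M s -> (forall x, exists n : nat, M (s *+ n + x)) ->
  exists f : V -> R,
    [/\ (forall x y, f (x + y) = f x + f y), (forall x, M x -> 0 <= f x) & f s = 1].
Proof.
move=> Mp Ms unit; have [M0 _ _] := Mp.
have [T [Tp MT Ttot]] := proper_submonoid_extend Mp.
have [T0 Tadd Tneg] := Tp.
have Tint (p : int) : T (s *~ p) -> 0 <= p.
  by case: p => // k; rewrite NegzE mulrNz => /Tneg.
have Tmul x n : T x -> T (x *+ n) by exact: proper_submonoid_mulrn.
pose S x := [set r : R | exists (p : int) (q : nat),
  r = p%:~R / q.+1%:R /\ T (x *+ q.+1 - s *~ p)].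
have S0 x : S x !=set0.
  have [n Mn] := unit x; exists ((- (n%:Z))%:~R / 1%:R), (- n%:Z), 0%N.
  by split=> //; rewrite mulr1n mulrNz opprK addrC; exact: MT.
have Sadd x y r t : S x r -> S y t -> S (x + y) (r + t).
  move=> [p [q [-> Tx]]] [p' [q' [-> Ty]]].
  exists (p * q'.+1%:Z + p' * q.+1%:Z), (q.+1 * q'.+1).-1.
  rewrite prednK ?muln_gt0//; split.
    rewrite rmorphD !rmorphM/= natrM.
    by field; rewrite !nat1r !pnatr_eq0.
  rewrite (_ : _ - _ = (x *+ q.+1 - s *~ p) *+ q'.+1 + (y *+ q'.+1 - s *~ p') *+ q.+1).
    by apply: Tadd; exact: Tmul.
  rewrite !mulrnBl -!mulrnA mulrnDl mulrzDr !mulrzA (mulnC q'.+1) addrACA opprD.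
  by rewrite -!pmulrn.
have Sle x n t : M (s *+ n - x) -> S x t -> t <= n%:R.
  move=> /MT Tn [p [q [-> Tx]]].
  have := Tadd _ _ (Tmul _ q.+1 Tn) Tx.
  rewrite mulrnBl addrA subrK -mulrnA pmulrn -mulrzBr => /Tint.
  rewrite subr_ge0 ler_pdivrMr ?ltr0n// => h.
  by rewrite -natrM -[(n * _)%:R]/((n * q.+1)%N%:Z%:~R) ler_int.
have Ssup x : has_sup (S x).
  split; first exact: S0.
  have [n Mn] := unit (- x); exists n%:R => t; exact: Sle.
pose f x := sup (S x).
have Sf x r : S x r -> r <= f x by move=> ?; exact: ub_le_sup (Ssup x).2 _ _.
have fS x b : (forall r, S x r -> r <= b) -> f x <= b.
  by move=> h; apply: ge_sup.
have supadd x y : f x + f y <= f (x + y).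
  rewrite -lerBrDr; apply: (fS) => r Sr.
  rewrite lerBrDr -lerBrDl; apply: fS => t St.
  by rewrite lerBrDl; apply: Sf; exact: Sadd.
have f0 : f 0 <= 0.
  by apply: fS => t /(Sle 0 0%N); apply; rewrite mulr0n subrr.
(* Suprema of cuts are only superadditive; oddness upgrades this to additivity. Here totality of [T]
   enters: a rational strictly between [f (- x)] and [- f x] would belong to the cut of [- x], or
   its opposite to the cut of [x]. *)
have fN x : f (- x) = - f x.
  apply/le_anti/andP; split.
    by have := supadd (- x) x; rewrite addNr; lra.
  rewrite leNgt; apply/negP => /rat_in_itvoo[q]; rewrite in_itv/= => /andP[qf qx].
  have : exists (p : int) n, ratr q = p%:~R / n.+1%:R :> R.
    exists (numq q), (`|denq q|.-1)%N; rewrite prednK ?absz_gt0 ?denq_neq0//.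
    by rewrite /ratr -[(`|denq q|%N)%:R]/((`|denq q|%N)%:Z%:~R) absz_denq.
  move=> [p [n qE]].
  have [Tx|Tx] := Ttot ((- x) *+ n.+1 - s *~ p).
    have := Sf (- x) (ratr q) (ex_intro _ p (ex_intro _ n (conj qE Tx))).
    by rewrite leNgt qf.
  have : S x (- ratr q).
    exists (- p), n; rewrite qE rmorphN mulNr; split=> //.
    by move: Tx; rewrite opprB mulNrn opprK mulrNz opprK addrC.
  by move=> /Sf; rewrite lerNl leNgt qx.
exists f; split.
- move=> x y; apply/le_anti/andP; split; last exact: supadd.
  by have := supadd (- x) (- y); rewrite -opprD !fN; lra.
- by move=> x Mx; apply: Sf; exists 0, 0%N; rewrite mul0r mulr0z subr0; split => //; exact: MT.
- apply/le_anti/andP; split.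
    by apply: fS => t /(Sle s 1%N); apply; rewrite mulr1n subrr.
  by apply: Sf; exists 1, 0%N; rewrite mulr1z subrr divr1.
Qed.
End OrderUnit.

Lemma additive_mulrz (V W : zmodType) (f : V -> W) :
  (forall x y, f (x + y) = f x + f y) -> forall x (n : int), f (x *~ n) = f x *~ n.
Proof.
move=> fD.
have f0 : f 0 = 0 by have := fD 0 0; rewrite addr0 -{1}[f 0]addr0 => /addrI/esym.
have fN x : f (- x) = - f x by apply/eqP; rewrite -addr_eq0 -fD addNr f0.
have fM x n : f (x *+ n) = f x *+ n.
  by elim: n => [|n ih]; rewrite ?mulr0n// !mulrS fD ih.
move=> x [n|n]; first by rewrite -!pmulrn fM.
by rewrite NegzE !mulrNz fN -!pmulrn fM.
Qed.

(** * Pairings on the lattice and functionals nonnegative on a subsemigroup *)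

Section Lattice.
Context {d : nat}.
Implicit Types (h w x : Zd d).

Definition rpairing {R : realType} (v : 'rV[R]_d) h : R :=
  \sum_i v 0 i * (h 0 i)%:~R.

Definition zpairing w h : int := \sum_i w 0 i * h 0 i.

Definition norm1 h : int := \sum_i `|h 0 i|.

Definition open_cone w : set (Zd d) := [set h | norm1 h < zpairing w h].

Lemma norm1D x h : norm1 (x + h) <= norm1 x + norm1 h.
Proof.
by rewrite /norm1 -big_split; apply: ler_sum => i _; rewrite mxE ler_normD.
Qed.

Lemma norm1N x : norm1 (- x) = norm1 x.
Proof. by apply: eq_bigr => i _; rewrite mxE normrN. Qed.

Lemma norm1_0 : norm1 0 = 0.
Proof. by rewrite /norm1 big1// => i _; rewrite mxE normr0. Qed.

Lemma zpairingD w x h : zpairing w (x + h) = zpairing w x + zpairing w h.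
Proof. by rewrite /zpairing -big_split; apply: eq_bigr => i _; rewrite mxE mulrDr. Qed.

Lemma zpairingN w x : zpairing w (- x) = - zpairing w x.
Proof. by rewrite /zpairing -sumrN; apply: eq_bigr => i _; rewrite mxE mulrN. Qed.

Lemma zpairing0 w : zpairing w 0 = 0.
Proof. by rewrite /zpairing big1// => i _; rewrite mxE mulr0. Qed.

Lemma zpairingNl w x : zpairing (- w) x = - zpairing w x.
Proof. by rewrite /zpairing -sumrN; apply: eq_bigr => i _; rewrite mxE mulNr. Qed.

Lemma norm1_delta i : norm1 (delta_mx 0 i) = 1.
Proof.
rewrite /norm1 (bigD1 i)//= mxE !eqxx/= big1 ?addr0// => j ji.
by rewrite mxE (negbTE ji) andbF normr0.
Qed.

Lemma zpairing_delta w i : zpairing w (delta_mx 0 i) = w 0 i.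
Proof.
rewrite /zpairing (bigD1 i)//= mxE !eqxx/= mulr1 big1 ?addr0// => j ji.
by rewrite mxE (negbTE ji) andbF mulr0.
Qed.

Lemma open_coneN w h : open_cone (- w) h = open_cone w (- h).
Proof. by rewrite /open_cone /= norm1N zpairingNl zpairingN. Qed.

Section RealPairing.
Context {R : realType}.
Implicit Types u v : 'rV[R]_d.

Lemma rpairingD v x h : rpairing v (x + h) = rpairing v x + rpairing v h.
Proof.
rewrite /rpairing -big_split; apply: eq_bigr => i _.
by rewrite !mxE rmorphD mulrDr.
Qed.

Lemma rpairingN v h : rpairing v (- h) = - rpairing v h.
Proof.
by rewrite /rpairing -sumrN; apply: eq_bigr => i _; rewrite mxE rmorphN mulrN.
Qed.

Lemma rpairing0 v : rpairing v 0 = 0.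
Proof. by rewrite /rpairing big1// => i _; rewrite mxE mulr0. Qed.

Lemma rpairingDl u v h : rpairing (u + v) h = rpairing u h + rpairing v h.
Proof. by rewrite /rpairing -big_split; apply: eq_bigr => i _; rewrite mxE mulrDl. Qed.

Lemma rpairingZl a v h : rpairing (a *: v) h = a * rpairing v h.
Proof. by rewrite /rpairing mulr_sumr; apply: eq_bigr => i _; rewrite mxE mulrA. Qed.

Lemma rpairingNl v h : rpairing (- v) h = - rpairing v h.
Proof. by rewrite -scaleN1r rpairingZl mulN1r. Qed.

Lemma rpairing0l h : rpairing (0 : 'rV[R]_d) h = 0.
Proof. by rewrite -(scale0r 0) rpairingZl mul0r. Qed.

Lemma rpairing_delta v i : rpairing v (delta_mx 0 i) = v 0 i.
Proof.
rewrite /rpairing (bigD1 i)//= mxE !eqxx/= mulr1 big1 ?addr0// => j ji.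
by rewrite mxE (negbTE ji) andbF mulr0.
Qed.

Lemma additive_rpairing (f : Zd d -> R) :
  (forall x y, f (x + y) = f x + f y) -> exists v, forall x, f x = rpairing v x.
Proof.
move=> fD.
have f0 : f 0 = 0 by have := fD 0 0; rewrite addr0 -{1}[f 0]addr0 => /addrI/esym.
exists (\row_i f (delta_mx 0 i)) => x.
rewrite {1}(row_sum_delta x) (big_morph f fD f0); apply: eq_bigr => i _.
by rewrite mxE -{1}(intz (x 0 i)) scaler_int (additive_mulrz fD) mulrzr.
Qed.

End RealPairing.

(** A subsemigroup may lack 0, which the order unit arguments require. *)
Definition monoid_hull (H : set (Zd d)) : set (Zd d) := [set h | h = 0 \/ H h].

Lemma monoid_hullD H x h : is_subsemigroup H ->
  monoid_hull H x -> monoid_hull H h -> monoid_hull H (x + h).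
Proof.
move=> Hs [->|Hx] [->|Hh]; rewrite ?addr0 ?add0r; [by left|by right|by right|].
by right; exact: Hs.
Qed.

Lemma monoid_hull_mulrn H x n : is_subsemigroup H ->
  monoid_hull H x -> monoid_hull H (x *+ n).
Proof.
move=> Hs Hx; elim: n => [|n ih]; first by rewrite mulr0n; left.
by rewrite mulrS; exact: monoid_hullD.
Qed.

(* The common order unit is the sum, over the basis, of elements s_i of the
   monoid with s_i +- e_i in the monoid. *)
Lemma generating_order_unit H : is_subsemigroup H -> group_gen H = setT ->
  exists2 s, monoid_hull H s & forall x, exists n, monoid_hull H (s *+ n + x).
Proof.
move=> Hs Hg; set M := monoid_hull H.
have M0 : M 0 by left.
have Madd x y : M x -> M y -> M (x + y) by exact: monoid_hullD.
(* The dominated elements form a subgroup, and each [h] in [H] is dominated by itself. *)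
have dominated x : exists s, [/\ M s, M (s + x) & M (s - x)].
  have : group_gen H x by rewrite Hg.
  move=> /(_ [set x | exists s, [/\ M s, M (s + x) & M (s - x)]]); apply.
    split; [|split].
    - by exists 0; rewrite addr0 subr0.
    - move=> a b [s [Ms s1 s2]] [t [Mt t1 t2]]; exists (s + t); split; first exact: Madd.
        by rewrite addrACA; exact: Madd.
      by rewrite opprD addrACA; exact: Madd.
    - by move=> a [s [Ms s1 s2]]; exists s; rewrite opprK.
  by move=> h Hh; exists h; rewrite subrr; split=> //; [right|apply: Madd; right].
have /choice[s_ sP] : forall i, exists s, [/\ M s, M (s + delta_mx 0 i) & M (s - delta_mx 0 i)].
  by move=> i; exact: dominated.
have Msum (P : pred 'I_d) : M (\sum_(i | P i) s_ i).
  by elim/big_ind : _ => // i _; case: (sP i).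
set s := \sum_i s_ i; exists s; first exact: Msum.
have se i : M (s + delta_mx 0 i) /\ M (s - delta_mx 0 i).
  have [_ s1 s2] := sP i.
  by rewrite /s (bigD1 i)//=; split; rewrite addrAC; exact: Madd.
have Mmul x n : M x -> M (x *+ n) by exact: monoid_hull_mulrn.
(* One copy of [s] pays for each unit of each coordinate: the sum splits into [|x_i|] copies of
   [s + e_i] or [s - e_i]. *)
move=> x; exists (\sum_i `|x 0%R i|)%N.
rewrite {2}(row_sum_delta x) -sumrMnr -big_split /=.
apply: (big_ind M) => // i _.
rewrite -{2}(intz (x 0 i)) scaler_int.
case: (x 0 i) => n /=; first by rewrite -pmulrn -mulrnDl; apply: Mmul; case: (se i).
by rewrite NegzE mulrNz -pmulrn -mulrnBl; apply: Mmul; case: (se i).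
Qed.

(** A negative multiple of the order unit in the monoid hull would absorb every element. So the hull
    is proper, and the functional it carries is nonzero because it equals 1 at the unit. *)
Lemma proper_semigroup_functional (R : realType) H : (0 < d)%N ->
  is_subsemigroup H -> group_gen H = setT -> H <> setT ->
  exists2 v : 'rV[R]_d, v != 0 & forall h, H h -> 0 <= rpairing v h.
Proof.
move=> d0 Hs Hg HT; have [s Ms sunit] := generating_order_unit Hs Hg.
have [|//|//|f [fD fH fs]] := @order_unit_functional _ s R (monoid_hull H).
  split; [by left|by move=> x y; exact: monoid_hullD|].
  move=> k Mk; apply: HT; rewrite -subTset.
  have MT x : monoid_hull H x.
    have [n Mn] := sunit x.
    (* The multiples of [s] cancel, as [n - (k + 1) n + k n = 0], and [x] remains. *)
    have := monoid_hullD Hs Mn (monoid_hullD Hs (monoid_hull_mulrn n Hs Mk)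
      (monoid_hull_mulrn (k * n) Hs Ms)).
    by rewrite mulNrn -mulrnA mulSn mulrnDr opprD subrK addrAC subrr add0r.
  have Hn0 x : x != 0 -> H x by have [->|//] := MT x; rewrite eqxx.
  move=> x _; have [->|/Hn0//] := eqVneq x 0.
  (* A full hull does not yet put 0 in [H]; it is reached as [e - e] with [e] nonzero, which exists
     since [d > 0]. *)
  pose e : Zd d := delta_mx 0 (Ordinal d0).
  have e0 : e != 0.
    by apply/eqP => /rowP/(_ (Ordinal d0)); rewrite !mxE !eqxx.
  by rewrite -(subrr e); apply: Hs; apply: Hn0; rewrite ?oppr_eq0.
have [v vE] := additive_rpairing fD; exists v.
  by apply/eqP => v0; move: fs; rewrite vE v0 rpairing0l => /esym/eqP; rewrite oner_eq0.
by move=> h Hh; rewrite -vE; apply: fH; right.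
Qed.

(* Hahn-Banach for the sublinear function norm1 - zpairing w, nonnegative on H. *)
Lemma dual_near_opposite (R : realType) H w : is_subsemigroup H ->
  (forall h, H h -> zpairing w h <= norm1 h) ->
  exists2 v : 'rV[R]_d, forall h, H h -> 0 <= rpairing v h &
    forall i, `|v 0 i + (w 0 i)%:~R| <= 1.
Proof.
move=> Hs wH; pose p x : int := norm1 x - zpairing w x.
have pD x y : p (x + y) <= p x + p y.
  by rewrite /p zpairingD; have := norm1D x y; lra.
have p0 : p 0 = 0 by rewrite /p norm1_0 zpairing0 subr0.
(* The extra integer coordinate encodes the bound [p]: with value 1 at [(0, 1)], nonnegativity at
   [(x, p (- x))] says that the functional is at most [p], and at [(h, 0)] that it is nonnegative on
   [H]. *)
pose M := [set z : Zd d * int | exists2 h, monoid_hull H h & p (h - z.1) <= z.2].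
have pM h : monoid_hull H h -> 0 <= p h.
  by move=> [->|/wH]; rewrite ?p0// /p subr_ge0.
have mulE (n : int) : ((0, 1) : Zd d * int) *~ n = (0, n).
  apply: injective_projections; first by rewrite (raddfMz fst) mul0rz.
  by rewrite (raddfMz snd) intz.
have [|||f [fD fM fs]] := @order_unit_functional _ ((0, 1) : Zd d * int) R M.
- split.
  + by exists 0; [left|rewrite subr0 p0].
  + move=> [x a] [y b] [h Mh ha] [k Mk kb]; exists (h + k); first exact: monoid_hullD.
    rewrite /= opprD addrACA; apply: le_trans (pD _ _) _; exact: lerD.
  + move=> k; rewrite pmulrn mulE => -[h /pM ph] /=.
    by rewrite oppr0 subr0 => hk; have := le_trans ph hk; lia.
- by exists 0; [left|rewrite subr0 p0].
- move=> [x a]; exists `|p (- x) - a|%N; rewrite pmulrn mulE.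
  exists 0; [by left|rewrite /= sub0r add0r -lerBlDr; lia].
have [|g gE] := @additive_rpairing R (fun x => f (x, 0)).
  by move=> x y; rewrite -fD; congr (f (_, _)); rewrite addr0.
have fE x n : f (x, n) = rpairing g x + n%:~R.
  rewrite -gE (_ : (x, n) = (x, 0) + (0, 1) *~ n); last first.
    by rewrite mulE; congr (_, _); rewrite ?addr0 ?add0r.
  by rewrite fD (additive_mulrz fD) fs.
exists g.
  move=> h Hh; have := fM (h, 0); rewrite fE addr0; apply.
  by exists h; [right|rewrite subrr p0].
have gp x : 0 <= rpairing g x + (p (- x))%:~R.
  by rewrite -fE; apply: fM; exists 0; [left|rewrite /= sub0r].
(* Since [p] takes the values [1 - w_i] and [1 + w_i] at the basis vector and its opposite,
   domination by [p] is exactly the required bound. *)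
move=> i; have := gp (delta_mx 0 i); have := gp (- delta_mx 0 i).
rewrite opprK /p norm1N zpairingN norm1_delta zpairing_delta.
rewrite rpairingN rpairing_delta opprK rmorphB rmorphD /= ler_norml.
by move=> ? ?; apply/andP; split; lra.
Qed.

End Lattice.

(** * Dual cones *)

Definition convex_cone (R : realType) (d : nat) (K : set 'rV[R]_d) : Prop :=
  [/\ K 0, (forall u v, K u -> K v -> K (u + v)) &
      forall a v, 0 <= a -> K v -> K (a *: v)].

Lemma convex_cone_comb (R : realType) (d k : nat) (K : set 'rV[R]_d)
    (A : 'M[R]_(k, d)) (c : 'rV[R]_k) :
  convex_cone K -> (forall i, K (row i A)) -> (forall i, 0 <= c 0 i) -> K (c *m A).
Proof.
move=> [K0 KD KZ] KA c0; rewrite mulmx_sum_row.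
by apply: (big_ind K) => // i _; exact: KZ.
Qed.

(** A largest linearly independent family in [K] spans [K], since a vector of [K] outside its span
    would enlarge it. The vector [v0] makes the family nonempty. *)
Lemma convex_cone_basis (R : realType) (d : nat) (K : set 'rV[R]_d) (v0 : 'rV[R]_d) :
  K v0 -> v0 != 0 ->
  exists k (A : 'M[R]_(k.+1, d)),
    [/\ (forall i, K (row i A)), row_free A & forall v, K v -> (v <= A)%MS].
Proof.
move=> Kv0 v0n0.
pose Q k := `[< exists A : 'M[R]_(k, d), (forall i, K (row i A)) /\ row_free A >].
have Q1 : Q 1%N.
  apply/asboolP; exists v0; split; first by move=> i; rewrite (ord1 i) row_id.
  by rewrite -row_leq_rank rank_rV v0n0.
have Qd k : Q k -> (k <= d)%N.
  by move=> /asboolP[A [_ /eqP <-]]; exact: rank_leq_col.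
have [[|k] /asboolP[A [KA Afree]] kmax] := ex_maxnP (ex_intro _ 1%N Q1) Qd.
  by have := kmax _ Q1.
exists k, A; split=> // v Kv; apply: contrapT => /negP vA.
suff /kmax : Q (k.+1 + 1)%N by rewrite addn1 ltnn.
apply/asboolP; exists (col_mx A v); split.
  move=> i; rewrite -(splitK i); case: (fintype.split i) => j /=.
    by rewrite rowKu.
  by rewrite rowKd (ord1 j) row_id.
have rA : (\rank A < \rank (A + v)%MS)%N; last first.
  by rewrite -row_leq_rank -(addsmxE A v) (leq_trans _ rA)// (eqP Afree) addn1.
apply: rank_ltmx; rewrite /ltmx addsmxSl/=; apply: contra vA; apply: submx_trans.
exact: addsmxSr.
Qed.

Section DualCones.
Context {R : realType} {d : nat}.

(** Take for [u] the sum of a basis drawn from [K]. For [N] large, any [v] of [K] near [- N u] has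
    only negative coordinates in that basis, so [- v] is a nonnegative combination of it. The
    tolerance 2 leaves 1 for rounding [N u] to the lattice and 1 for [dual_near_opposite]. *)
Lemma near_opposite_in_cone (K : set 'rV[R]_d) v0 : convex_cone K -> K v0 -> v0 != 0 ->
  exists2 u, K u & exists N : nat, forall v, K v ->
    (forall i, `|v 0 i + N%:R * u 0 i| <= 2) -> v != 0 /\ K (- v).
Proof.
move=> Kc Kv0 v0n0; have [k [A [KA Afree AK]]] := convex_cone_basis Kv0 v0n0.
pose u : 'rV[R]_d := const_mx 1 *m A.
exists u; first by apply: convex_cone_comb => // i; rewrite mxE.
(* A crude bound for the passage to coordinates: an error of 2 in each entry changes each coordinate
   by at most [2 * L]. *)
pose L := \sum_(p : 'I_d * 'I_k.+1) `|pinvmx A p.1 p.2|.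
have [N LN] : exists N : nat, 2 * L < N%:R.
  by exists (Num.bound (2 * L)); apply: archi_boundP; rewrite mulr_ge0// sumr_ge0.
exists N => v Kv near.
pose c := v *m pinvmx A.
have vE : v = c *m A by rewrite mulmxKpV//; exact: AK.
have cneg i : c 0 i < 0.
  have eE : (v + N%:R *: u) *m pinvmx A = c + N%:R *: const_mx 1.
    by rewrite mulmxDl -scalemxAl mulmxKp.
  have : `|((v + N%:R *: u) *m pinvmx A) 0 i| <= 2 * L.
    rewrite mxE (le_trans (ler_norm_sum _ _ _))// mulr_sumr.
    rewrite -(pair_bigA _ (fun j l => 2 * `|pinvmx A j l|))/=.
    apply: ler_sum => j _; rewrite (bigD1 i)//=; apply: ler_wpDr.
      by rewrite sumr_ge0// => l _; rewrite mulr_ge0.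
    by rewrite normrM ler_wpM2r// mxE [X in _ + X]mxE.
  have -> : ((v + N%:R *: u) *m pinvmx A) 0 i = c 0 i + N%:R.
    by rewrite eE mxE; congr (_ + _); rewrite !mxE mulr1.
  rewrite ler_norml => /andP[_].
  by move: LN; lra.
split.
  apply/eqP => v0E; have := cneg 0.
  by rewrite /c v0E mul0mx mxE ltxx.
rewrite vE -mulNmx; apply: convex_cone_comb => // i.
by rewrite mxE oppr_ge0 ltW.
Qed.

(* The increasing union K of the dual cones of the H n has symmetric closure by
   [Hsym], so, being convex, it would contain a line unless it is 0. *)
Lemma symmetric_tests_full (H : nat -> set (Zd d)) : (0 < d)%N ->
  (forall n, is_subsemigroup (H n)) -> (forall n, H n.+1 `<=` H n) ->
  (forall n, group_gen (H n) = setT) ->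
  (forall w, (forall n, H n `&` open_cone w !=set0) ->
             (forall n, H n `&` open_cone (- w) !=set0)) ->
  forall n, H n = setT.
Proof.
move=> d0 Hs Hdec Hg Hsym n0; apply: contrapT => Hn0.
have Hle m n : (m <= n)%N -> H n `<=` H m.
  move=> /subnK <-; elim: (n - m)%N => [|k ih]; first by rewrite add0n.
  by rewrite addSn; apply: subset_trans ih; exact: Hdec.
pose K := [set v : 'rV[R]_d | exists n, forall h, H n h -> 0 <= rpairing v h].
have Kc : convex_cone K.
  split.
  - by exists 0%N => h _; rewrite rpairing0l.
  - move=> u v [m um] [n vn]; exists (maxn m n) => h Hh.
    rewrite rpairingDl addr_ge0//; [apply: um|apply: vn].
      exact: (Hle _ _ (leq_maxl m n)).
    exact: (Hle _ _ (leq_maxr m n)).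
  - move=> a v a0 [n vn]; exists n => h Hh.
    by rewrite rpairingZl mulr_ge0// vn.
have [v0 v0n0 v0H] := proper_semigroup_functional R d0 (Hs n0) (Hg n0) Hn0.
have [|u [n uH] [N Nu]] := near_opposite_in_cone Kc _ v0n0; first by exists n0.
pose w : Zd d := \row_i Num.floor (N%:R * u 0 i).
have wu i : `|(w 0 i)%:~R - N%:R * u 0 i| <= 1.
  rewrite mxE ler_norml; have := floor_le (N%:R * u 0 i).
  by have := ltW (floorD1_gt (N%:R * u 0 i)); rewrite intrD; lra.
(* Otherwise, by [Hsym], some [h] in [H n] satisfies [<w, h> < - |h|_1]. But [w] is within 1 of
   [N u] in each entry and [u] is nonnegative on [H n], so [<w, h> >= - |h|_1]. *)
have [m mw] : exists m, forall h, H m h -> zpairing w h <= norm1 h.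
  apply: contrapT => no.
  have /Hsym /(_ n) [h [Hh]] : forall m, H m `&` open_cone w !=set0.
    move=> m; apply: contrapT => nm; apply: no; exists m => h Hh.
    by rewrite leNgt; apply/negP => wh; apply: nm; exists h.
  rewrite /open_cone/= zpairingNl; apply/negP; rewrite -leNgt.
  rewrite -(ler_int R) rmorphN lerNl.
  apply: le_trans (_ : N%:R * rpairing u h - (norm1 h)%:~R <= _).
    by rewrite lerBrDr addNr mulr_ge0// uH.
  rewrite lerBlDr -lerBlDl -rpairingZl rmorph_sum rmorph_sum/= -sumrB.
  apply: ler_sum => i _; rewrite mxE intrM -mulrBl (le_trans (ler_norm _))//.
  by rewrite normrM intr_norm ler_piMl// distrC wu.
have [v vH vw] := dual_near_opposite R (Hs m) mw.
have Kv : K v by exists m.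
have [|vn0 [l vl]] := Nu v Kv.
  move=> i; rewrite (_ : _ + _ = (v 0 i + (w 0 i)%:~R) - ((w 0 i)%:~R - N%:R * u 0 i)).
    by rewrite (le_trans (ler_normB _ _))// (_ : 2 = 1 + 1)// lerD.
  by lra.
suff v0E : v = 0 by rewrite v0E eqxx in vn0.
apply/rowP => i; rewrite mxE -rpairing_delta.
have : group_gen (H (maxn m l)) (delta_mx 0 i) by rewrite Hg.
(* Both [v] and [- v] are nonnegative on this semigroup, so the kernel of [v] is a subgroup
   containing it. *)
move=> /(_ [set x | rpairing v x = 0]); apply.
  split; first exact: rpairing0.
  split=> [x y /= vx vy|x /= vx]; first by rewrite rpairingD vx vy addr0.
  by rewrite rpairingN vx oppr0.
move=> h Hh; apply/le_anti; rewrite vH ?andbT; last exact: (Hle _ _ (leq_maxl m l)).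
by rewrite -oppr_ge0 -rpairingNl vl//; exact: (Hle _ _ (leq_maxr m l)).
Qed.
End DualCones.

(** * Averages of pairwise independent events *)

Lemma ae_forall_countable {dsp : measure_display} {Omega : measurableType dsp}
    {R : realType} (P : probability Omega R) (T : countType) (Q : T -> Omega -> Prop) :
  (forall t, {ae P, forall o, Q t o}) -> {ae P, forall o, forall t, Q t o}.
Proof.
move=> hQ.
have : {ae P, forall o, forall n, if unpickle n is Some t then Q t o else True}.
  apply: ae_foralln => n; case: (unpickle n) => [t|]; first exact: hQ.
  by apply: aeW.
by apply: filterS => o ho t; have := ho (pickle t); rewrite pickleK.
Qed.

Section Average.
Context {dsp : measure_display} {Omega : measurableType dsp} {R : realType}.
Variable P : probability Omega R.

(** The double sum is the expectation of the square of the combination of indicators with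
    coefficients [a i]. *)
Lemma gram_ge0 (I : finType) (B : I -> set Omega) (a : I -> R) :
  (forall i, measurable (B i)) ->
  0 <= \sum_i \sum_j a i * a j * fine (P (B i `&` B j)).
Proof.
move=> mB; rewrite pair_bigA /=.
have mBB i j : measurable (B i `&` B j) by exact: measurableI.
rewrite -lee_fin -sumEFin.
rewrite (eq_bigr (fun p : I * I =>
    \int[P]_x ((a p.1 * a p.2)%:E * (\1_(B p.1 `&` B p.2) x)%:E)))%E; last first.
  move=> [i j] _ /=; rewrite integralZl//; last exact: integrable_indic.
  by rewrite integral_indic// setIT EFinM fineK// fin_num_measure.
rewrite -integral_sum//; last first.
  by move=> [i j]; apply: integrableZl => //; exact: integrable_indic.
apply: integral_ge0 => x _; rewrite (eq_bigr (fun p : I * I =>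
    ((a p.1 * \1_(B p.1) x) * (a p.2 * \1_(B p.2) x))%:E)); last first.
  by move=> [i j] _ /=; rewrite indicI/= -EFinM; congr (_%:E); ring.
rewrite sumEFin lee_fin -(pair_bigA _ (fun i j => (a i * \1_(B i) x) * (a j * \1_(B j) x)))/=.
by rewrite -big_distrlr /= -expr2 sqr_ge0.
Qed.

(* Weak law of large numbers: A has the same covariance with each C j, hence
   the same covariance with their averages, which tend to p in L^2. *)
Lemma pairwise_indep_average (A : set Omega) (C : nat -> set Omega) (c p : R) :
  measurable A -> (forall j, measurable (C j)) ->
  (forall j, P (A `&` C j) = c%:E) -> (forall j, P (C j) = p%:E) ->
  (forall i j, i != j -> P (C i `&` C j) = (p * p)%:E) ->
  c%:E = (P A * p%:E)%E.
Proof.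
move=> mA mC PAC PC PCC.
set a := fine (P A).
have aE : P A = a%:E by rewrite /a fineK// fin_num_measure.
rewrite aE -EFinM; congr (_%:E).
have PT : P setT = 1%:E by exact: probability_setT.
(* This is the second moment of the average of [n + 1] indicators of the [C j], minus [p], minus [t]
   times the indicator of [A]. *)
have key (n : nat) t : 0 <= (p - p * p) / n.+1%:R - 2 * t * (c - a * p) + t ^+ 2 * a.
  pose B (i : option (option 'I_n.+1)) :=
    match i with None => A | Some None => setT | Some (Some j) => C j end.
  pose al (i : option (option 'I_n.+1)) : R :=
    match i with None => - t | Some None => - p | Some (Some j) => n.+1%:R^-1 end.
  have mB i : measurable (B i) by case: i => [[j|]|] /=.
  have := gram_ge0 al mB.
  have optE (T : finType) (F : option T -> R) : \sum_i F i = F None + \sum_i F (Some i).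
    rewrite (bigD1 None)//=; congr (_ + _).
    rewrite (reindex_omap Some id)//=; first by apply: eq_bigl => i; rewrite eqxx.
    by case.
  rewrite !optE /=; set N : R := n.+1%:R.
  rewrite setIid !setIT !setTI PT aE /=.
  have N0 : N != 0 by rewrite /N pnatr_eq0.
  have sumc (F : 'I_n.+1 -> R) e : (forall j, F j = e) -> \sum_j F j = N * e.
    by move=> FE; rewrite (eq_bigr _ (fun j _ => FE j)) sumr_const card_ord mulr_natl.
  rewrite (sumc _ (- t * N^-1 * c)); last by move=> j; rewrite PAC.
  rewrite (sumc _ (- p * N^-1 * p)); last by move=> j; rewrite setTI PC.
  rewrite (sumc _ (N^-1 * - t * c + (N^-1 * - p * p +
    (N^-1 * N^-1 * p + n%:R * (N^-1 * N^-1 * (p * p)))))); last first.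
    move=> j; rewrite !optE /= (setIC _ A) PAC setIT PC /=; congr (_ + (_ + _)).
    rewrite (bigD1 j)//= setIid PC; congr (_ + _).
    rewrite (eq_bigr (fun=> N^-1 * N^-1 * (p * p))); last first.
      by move=> i ij; rewrite PCC// eq_sym.
    by rewrite sumr_const cardC1 card_ord mulr_natl.
  have nE : n%:R = N - 1 :> R by rewrite /N mulrSr addrK.
  rewrite nE; congr (_ <= _); field.
  by rewrite nat1r.
have key2 t : 0 <= - 2 * t * (c - a * p) + t ^+ 2 * a.
  apply/ler_addgt0Pl => e e0.
  have [n nE] : exists n : nat, (p - p * p) / e < n.+1%:R.
    exists (Num.bound `|(p - p * p) / e|).
    rewrite (le_lt_trans (ler_norm _))// (lt_le_trans (archi_boundP _))//.
    by rewrite ler_nat.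
  have : (p - p * p) / n.+1%:R <= e.
    by rewrite ler_pdivrMr ?ltr0n// -ler_pdivrMl// mulrC ltW.
  by have := key n t; move: (_ / _) => X hX Xe; lra.
have a0 : 0 <= a by rewrite /a fine_ge0.
(* For [a > 0] the quadratic in [t] is tested at its minimum [(c - a p) / a]; for [a = 0] it is
   linear and [t = c - a p] suffices. *)
have [a_eq0|an0] := eqVneq a 0.
  have := key2 (c - a * p); rewrite a_eq0; nra.
have := key2 ((c - a * p) / a).
have -> : - 2 * ((c - a * p) / a) * (c - a * p) + ((c - a * p) / a) ^+ 2 * a
    = - ((c - a * p) ^+ 2 / a).
  by field.
rewrite oppr_ge0 pmulr_lle0 ?invr_gt0 ?lt_def ?an0// => sq.
by apply/eqP; rewrite -subr_eq0 -sqrf_eq0 eq_le sq sqr_ge0.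
Qed.
End Average.

(** * Independent identically distributed sequences *)

Section PiLambda.
Context {dsp : measure_display} {Omega : measurableType dsp} {R : realType}.
Context {S : Type} (G : set (set S)).
Variables (mu nu : {measure set Omega -> \bar R}) (X Y : Omega -> S).

Lemma sigma_algebra_preimage_measurable : (forall B, G B -> measurable (X @^-1` B)) ->
  forall B, <<s G >> B -> measurable (X @^-1` B).
Proof.
move=> GX B; apply: (@smallest_sub _ _ _ [set B | measurable (X @^-1` B)]) => //.
split.
- by rewrite /= preimage_set0.
- by move=> A mA; rewrite /= setTD preimage_setC; exact: measurableC.
- by move=> F mF; rewrite /= preimage_bigcup; apply: bigcup_measurable => k _; exact: mF.
Qed.

(** The sets on which the image measures agree form a Dynkin system. Two maps serve to compare the
    laws of two sequences, two measures to compare a restriction of [P] with a multiple of [P]. *)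
Lemma finite_measure_pi_eq : setI_closed G ->
  (forall B, G B -> measurable (X @^-1` B)) -> (forall B, G B -> measurable (Y @^-1` B)) ->
  (mu setT < +oo)%E -> mu setT = nu setT ->
  (forall B, G B -> mu (X @^-1` B) = nu (Y @^-1` B)) ->
  forall B, <<s G >> B -> mu (X @^-1` B) = nu (Y @^-1` B).
Proof.
move=> GI mX mY fin T_eq G_eq.
suff : <<s G >> `<=` [set B | [/\ measurable (X @^-1` B), measurable (Y @^-1` B)
    & mu (X @^-1` B) = nu (Y @^-1` B)]] by move=> h B /h[].
rewrite -(setI_closed_g_dynkin_g_sigma_algebra GI); apply: smallest_sub; last first.
  by move=> B GB; split; [exact: mX|exact: mY|exact: G_eq].
split.
- by split; rewrite ?preimage_setT.
- move=> B [mXB mYB eqB].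
  rewrite /= -[X @^-1` _]/(~` (X @^-1` B)) -[Y @^-1` _]/(~` (Y @^-1` B)).
  split; [exact: measurableC..|].
  rewrite -(setTD (X @^-1` B)) -(setTD (Y @^-1` B)).
  have nfin : (nu setT < +oo)%E by rewrite -T_eq.
  rewrite (measureD (mu := mu))// (measureD (mu := nu))//; congr (_ - _)%E; first exact: T_eq.
  by rewrite (setTI (X @^-1` B)) (setTI (Y @^-1` B)); exact: eqB.
- move=> F tF EF; rewrite /= !preimage_bigcup; split.
  + by apply: bigcup_measurable => k _; case: (EF k).
  + by apply: bigcup_measurable => k _; case: (EF k).
  + rewrite !measure_bigcup//.
    * by apply: eq_eseriesr => k _; case: (EF k).
    * by move=> k _; case: (EF k).
    * by move=> i j _ _ [w [Fi Fj]]; apply: tF => //; exists (Y w).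
    * by move=> k _; case: (EF k).
    * by move=> i j _ _ [w [Fi Fj]]; apply: tF => //; exists (X w).
Qed.
End PiLambda.

(* [g_sigma_algebraType] on sequences in Z^d asks for a pointed carrier. *)
HB.instance Definition _ := isPointed.Build int 0.

Section IID.
Context {d : nat}.
Implicit Types (x : nat -> Zd d) (s : seq nat).

Definition cylinder s (gs : nat -> Zd d) : set (nat -> Zd d) :=
  [set x | forall i, i \in s -> x i = gs i].

(** The empty set is added to get a pi-system: incompatible cylinders are disjoint, while no
    cylinder is empty. *)
Definition cylinders : set (set (nat -> Zd d)) :=
  [set B | B = set0 \/ exists s gs, B = cylinder s gs].

Lemma cylinders_setI : setI_closed cylinders.
Proof.
move=> B1 B2 [->|[s [gs ->]]]; first by left; rewrite set0I.
move=> [->|[t [hs ->]]]; first by left; rewrite setI0.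
have [->|/set0P[x [xs xt]]] := eqVneq (cylinder s gs `&` cylinder t hs) set0.
  by left.
right; exists (s ++ t), x; apply/seteqP; split => y.
  move=> [ys yt] i; rewrite mem_cat => /orP[i_s|i_t].
    by rewrite ys// xs.
  by rewrite yt// xt.
move=> yx; split=> i i_s.
  by rewrite yx ?xs// mem_cat i_s.
by rewrite yx ?xt// mem_cat i_s orbT.
Qed.

Section Law.
Context {dsp : measure_display} {Omega : measurableType dsp} {R : realType}.
Variables (P : probability Omega R) (mu : Zd d -> R).
Implicit Types zeta : Omega -> nat -> Zd d.

(** Independence and common law in one product formula; a repeated index would count its factor
    twice, hence [uniq]. *)
Definition iid zeta : Prop :=
  (forall i g, measurable [set o | zeta o i = g]) /\
  forall s gs, uniq s -> P (zeta @^-1` cylinder s gs) = (\prod_(i <- s) mu (gs i))%:E.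

Lemma iid_measurable zeta : iid zeta ->
  forall B, <<s cylinders >> B -> measurable (zeta @^-1` B).
Proof.
move=> [mz _]; apply: sigma_algebra_preimage_measurable => _ [->|[s [gs ->]]].
  by rewrite preimage_set0.
rewrite (_ : _ @^-1` _ = \bigcap_(i in [set` s]) [set o | zeta o i = gs i]).
  by apply: fin_bigcap_measurable => //; exact: finite_seq.
by apply/seteqP; split => o h i; exact: h.
Qed.

Lemma iid_cylinder zeta s gs : iid zeta ->
  P (zeta @^-1` cylinder s gs) = (\prod_(i <- undup s) mu (gs i))%:E.
Proof.
move=> [_ <-]; last exact: undup_uniq.
congr (P (_ @^-1` _)); apply/seteqP; split => x h i i_s; apply: h; move: i_s; by rewrite mem_undup.
Qed.

Lemma iid_same_law zeta xi : iid zeta -> iid xi ->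
  forall B, <<s cylinders >> B -> P (zeta @^-1` B) = P (xi @^-1` B).
Proof.
move=> iz ix; apply: finite_measure_pi_eq => //.
- exact: cylinders_setI.
- by move=> B GB; apply: iid_measurable => //; exact: sub_sigma_algebra.
- by move=> B GB; apply: iid_measurable => //; exact: sub_sigma_algebra.
- by apply: le_lt_trans (probability_le1 P measurableT) _; exact: ltry.
- move=> B [->|[s [gs ->]]]; first by rewrite !preimage_set0.
  exact: etrans (iid_cylinder s gs iz) (esym (iid_cylinder s gs ix)).
Qed.

Lemma iid_reindex zeta (f : nat -> nat) : involutive f -> iid zeta ->
  iid (fun o i => zeta o (f i)).
Proof.
move=> ff [mz Pz]; split=> [i g|s gs us]; first exact: mz.
have := Pz (map f s) (gs \o f).
rewrite map_inj_uniq; last exact: inv_inj.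
move=> /(_ us); rewrite big_map /= (eq_bigr (fun i => mu (gs i))); last by move=> i _; rewrite ff.
move=> <-; congr (P _); apply/seteqP; split => o /= h i.
  by move=> /mapP[j js ->]; rewrite /= ff h.
by move=> i_s; rewrite h /= ?ff//; exact: map_f.
Qed.

Lemma iid_opp zeta : (forall g, mu g = mu (- g)) -> iid zeta ->
  iid (fun o i => - zeta o i).
Proof.
move=> mu_sym [mz Pz]; split=> [i g|s gs us].
  rewrite (_ : [set o | _] = [set o | zeta o i = - g])//.
  by apply/seteqP; split => o /=; [move=> <-; rewrite opprK|move=> ->; rewrite opprK].
rewrite (eq_bigr _ (fun i _ => mu_sym (gs i))) -Pz//; congr (P _).
by apply/seteqP; split => o /= h i i_s; have := h i i_s;
  [move=> <-; rewrite opprK|move=> ->; rewrite opprK].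
Qed.

(** The involution exchanging the initial block of length [k] with the block of index [j + 1];
    distinct [j] use disjoint blocks. *)
Definition block_swap (k j i : nat) : nat :=
  if (i < k)%N then (i + j.+1 * k)%N
  else if (j.+1 * k <= i < j.+2 * k)%N then (i - j.+1 * k)%N else i.

Lemma block_swapK k j : involutive (block_swap k j).
Proof.
move=> i; rewrite /block_swap (mulSn j.+1).
have := leq_pmull k (ltn0Sn j); move: (j.+1 * k)%N => M kM.
by case: (boolP (i < k)%N); case: (boolP (M <= i < k + M)%N) => ? ?; repeat (case: ifP => ?); lia.
Qed.

Lemma iid_block_shift zeta (s : seq nat) gs k : all (fun i => i < k)%N s -> uniq s -> iid zeta ->
  let C j := [set o | forall i, i \in s -> zeta o (i + j.+1 * k)%N = gs i] in
  [/\ forall j, measurable (C j),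
      forall j, P (C j) = (\prod_(i <- s) mu (gs i))%:E &
      forall i j, i != j -> P (C i `&` C j) =
        (\prod_(i <- s) mu (gs i) * \prod_(i <- s) mu (gs i))%:E].
Proof.
move=> /allP sk us iz C.
pose sh j := [seq (i + j.+1 * k)%N | i <- s].
(* Reduction modulo [k] recovers the position inside a block, so one family of values serves for all
   blocks. *)
have CE j : C j = zeta @^-1` cylinder (sh j) (fun m => gs (m %% k)%N).
  apply/seteqP; split => o /= h i.
    by move=> /mapP[a a_s ->]; rewrite h//= addnC modnMDl modn_small// sk.
  move=> i_s; rewrite h; last exact: map_f.
  by rewrite addnC modnMDl modn_small// sk.
have ush j : uniq (sh j) by rewrite map_inj_uniq// => a b /addIn.
have prodE j : \prod_(i <- sh j) mu (gs (i %% k)%N) = \prod_(i <- s) mu (gs i).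
  rewrite big_map; apply: eq_big_seq => i /sk ik.
  by rewrite addnC modnMDl modn_small.
split.
- move=> j; rewrite CE; apply: iid_measurable => //; apply: sub_sigma_algebra.
  by right; exists (sh j), (fun m => gs (m %% k)%N).
- by move=> j; rewrite CE iz.2// prodE.
- move=> i j ij; rewrite !CE.
  rewrite (_ : _ `&` _ = zeta @^-1` cylinder (sh i ++ sh j) (fun m => gs (m %% k)%N)); last first.
    apply/seteqP; split => o /=.
      by move=> [hi hj] m; rewrite mem_cat => /orP[/hi|/hj].
    by move=> h; split => m hm; apply: h; rewrite mem_cat hm ?orbT.
  rewrite iz.2; first by rewrite big_cat /= !prodE.
  rewrite cat_uniq !ush andbT /=; apply/hasPn => _ /mapP[a /sk ak ->].
  apply/negP => /mapP[b /sk bk]; move: ij => /eqP ij; nia.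
Qed.

(* Hewitt-Savage: B is independent of every cylinder, because swapping the
   coordinates of the cylinder with far away ones leaves B unchanged. *)
Lemma hewitt_savage zeta (B : set (nat -> Zd d)) : iid zeta -> <<s cylinders >> B ->
  (forall f x, involutive f -> (exists N, forall i, (N <= i)%N -> f i = i) ->
     B x -> B (x \o f)) ->
  P (zeta @^-1` B) = 0%E \/ P (zeta @^-1` B) = 1%E.
Proof.
move=> iz mB Binv; set A := zeta @^-1` B.
have mA : measurable A by exact: iid_measurable iz _ mB.
have Acyl s gs : P (A `&` zeta @^-1` cylinder s gs) = (P A * P (zeta @^-1` cylinder s gs))%E.
  wlog us : s / uniq s.
    move=> /(_ (undup s) (undup_uniq s)).
    rewrite (_ : cylinder (undup s) gs = cylinder s gs)//.
    apply/seteqP; split => x h i i_s; apply: h; move: i_s; by rewrite mem_undup.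
  pose k := (\max_(i <- s) i).+1.
  have sk : all (fun i => i < k)%N s by apply/allP => i i_s; rewrite ltnS; exact: leq_bigmax_seq.
  have [mC PC PCC] := iid_block_shift gs sk us iz.
  have mcyl : <<s cylinders >> (cylinder s gs) by apply: sub_sigma_algebra; right; exists s, gs.
  set c := P (A `&` zeta @^-1` cylinder s gs).
  have cE : c = (fine c)%:E.
    by rewrite fineK// fin_num_measure//; apply: measurableI => //; exact: iid_measurable iz _ mcyl.
  rewrite iz.2// cE; apply: (pairwise_indep_average mA mC) => // j.
  (* The swapped sequence has the same law; the swap preserves [B] and moves the cylinder to its far
     copy [C j]. *)
  rewrite -cE /c -[X in _ = P X]/(zeta @^-1` (B `&` cylinder s gs)).
  rewrite [RHS](iid_same_law iz (iid_reindex (block_swapK k j) iz)); last first.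
    exact: (@measurableI _ (g_sigma_algebraType cylinders)).
  have fin_swap : exists N, forall i, (N <= i)%N -> block_swap k j i = i.
    exists (j.+2 * k)%N => i; rewrite /block_swap (mulSn j.+1).
    have := leq_pmull k (ltn0Sn j); move: (j.+1 * k)%N => M kM Ni.
    by repeat (case: ifP => ?); lia.
  congr (P _); apply/seteqP; split => o /= [Bo Co]; split.
  - exact: (Binv (block_swap k j)) (block_swapK k j) fin_swap Bo.
  - by move=> i i_s; rewrite -Co// /block_swap (allP sk _ i_s).
  - rewrite /A /preimage/=.
    have := Binv (block_swap k j) _ (block_swapK k j) fin_swap Bo.
    by congr B; apply/funext => i /=; rewrite block_swapK.
  - by move=> i i_s; have := Co i i_s; rewrite /block_swap (allP sk _ i_s).
have a0 : 0 <= fine (P A) by rewrite fine_ge0.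
have PA : P A = (fine (P A))%:E by rewrite fineK// fin_num_measure.
(* Independence extends from cylinders to the sigma-algebra they generate, hence to [B]: the event
   [A] is independent of itself. *)
have : P (A `&` A) = ((fine (P A))%:E * P A)%E.
  apply: (@finite_measure_pi_eq _ _ R _ cylinders (mrestr P mA) (mscale (NngNum a0) P) zeta zeta
    cylinders_setI) => //.
  - by move=> D GD; apply: iid_measurable => //; exact: sub_sigma_algebra.
  - by move=> D GD; apply: iid_measurable => //; exact: sub_sigma_algebra.
  - by rewrite /= /mrestr setTI PA ltry.
  - by rewrite /= /mrestr /mscale /= setTI probability_setT mule1.
  - move=> D [->|[s [gs ->]]]; rewrite /= /mrestr /mscale /=.
      by rewrite preimage_set0 set0I measure0 mule0.
    by rewrite setIC Acyl {1}PA.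
rewrite setIid PA -EFinM => -[] /eqP.
rewrite -subr_eq0 -{1}(mulr1 (fine _)) -mulrBr mulf_eq0 => /orP[/eqP ->|]; first by left.
by rewrite subr_eq0 => /eqP <-; right.
Qed.

End Law.
End IID.

(** * Random semigroups *)

(** A countable union over [G], which is either the lattice or the set of finite lists of times. *)
Lemma measurable_meets {dsp : measure_display} {T : measurableType dsp} (G : countType)
    (K : T -> set G) (U : set G) :
  (forall g, measurable [set t | K t g]) -> measurable [set t | K t `&` U !=set0].
Proof.
move=> mK; rewrite (_ : [set t | _] = \bigcup_g [set t | K t g /\ U g]).
  apply: countable_bigcupT_measurable => [|g]; first exact: countableP.
  have [Ug|nUg] := pselect (U g).
    by rewrite (_ : [set t | _] = [set t | K t g])//; apply/seteqP; split => t // [].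
  by rewrite (_ : [set t | _] = set0)//; apply/seteqP; split => t // [].
by apply/seteqP; split=> [t [g [Kg Ug]]|t [g _ [Kg Ug]]]; exists g.
Qed.

(** The common core of both claims: continuity from above carries the equality of probabilities from
    each [H n] to the event that all of them meet the cone. *)
Lemma zero_one_semigroups_full {dsp : measure_display} {Omega : measurableType dsp}
    {R : realType} (P : probability Omega R) (d : nat) (H : nat -> Omega -> set (Zd d)) :
  (0 < d)%N -> random_subsemigroups H -> decreasing_semigroups H -> non_degenerate P H ->
  (forall n w, P [set o | H n o `&` open_cone w !=set0] =
               P [set o | H n o `&` open_cone (- w) !=set0]) ->
  (forall w, P [set o | forall n, H n o `&` open_cone w !=set0] = 0%E \/
             P [set o | forall n, H n o `&` open_cone w !=set0] = 1%E) ->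
  {ae P, forall o, forall n, H n o = setT}.
Proof.
move=> d0 [Hs mH] Hdec Hg Hsym H01.
pose E n w := [set o | H n o `&` open_cone w !=set0].
have mE n w : measurable (E n w) by exact: measurable_meets.
pose F w := [set o | forall n, H n o `&` open_cone w !=set0].
have FE w : F w = \bigcap_n E n w.
  by apply/seteqP; split => [t Ft n _|t Ft n]; exact: Ft.
have mF w : measurable (F w) by rewrite FE; exact: bigcap_measurable.
have cvgF w : P \o (E^~ w) @ \oo --> P (F w).
  rewrite FE; apply: nonincreasing_cvg_mu => //.
  - by apply: le_lt_trans (probability_le1 P (mE _ _)) _; exact: ltry.
  - by rewrite -FE.
  - apply/nonincreasing_seqP => n; apply/subsetPset => o [h [Hh wh]].
    by exists h; split => //; exact: Hdec.
have PF w : P (F w) = P (F (- w)).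
  apply: (cvg_unique _ (cvgF w)) => //.
  rewrite (_ : P \o _ = P \o (E^~ (- w))); first exact: cvgF.
  by apply/funext => n; exact: Hsym.
have sym w : {ae P, forall o, F w o -> F (- w) o}.
  (* Either [F w] is null, or [F (- w)] has probability 1 as well. *)
  have [F0|F1] := H01 w.
    exists (F w); split => // o /= ho.
    by apply: contrapT => nF; apply: ho.
  exists (~` F (- w)); split; first exact: measurableC.
    by rewrite probability_setC// -PF F1 subee.
  by move=> o /= ho Fo; apply: ho.
have {}sym := ae_forall_countable sym.
move: Hg sym; apply: filterS2 => o Hgo symo.
by apply: (symmetric_tests_full (R := R)) => // n; exact: Hdec.
Qed.

Lemma liouville_symmetric_full {dsp : measure_display} {Omega : measurableType dsp}
    {R : realType} (P : probability Omega R) (d : nat) (H : nat -> Omega -> set (Zd d)) :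
  (0 < d)%N -> random_subsemigroups H -> decreasing_semigroups H ->
  non_degenerate P H -> liouville P H -> symmetric_seq P H ->
  {ae P, forall o, forall n, H n o = setT}.
Proof.
move=> d0 Hr Hdec Hg Hl Hsym; apply: zero_one_semigroups_full => //.
  move=> n w; rewrite (Hsym n [set S | S `&` open_cone w !=set0]).
    congr (P _); apply/seteqP; split => o [h [Hh wh]]; exists (- h); split => //=.
    - by rewrite open_coneN opprK.
    - by rewrite /set_inv/= opprK.
    - by rewrite -open_coneN.
  apply: (@measurable_meets _ (g_sigma_algebraType
    [set [set S : set (Zd d) | S g] | g in [set: Zd d]])).
  by move=> g; apply: sub_sigma_algebra; exists g.
move=> w; apply: Hl => n.
pose G := [set A : set Omega | exists m g, (n <= m)%N /\ A = [set o | H m o g]].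
(* As [H] is decreasing, dropping the first [n] terms does not change the event, so it lies in every
   future sigma-algebra. *)
rewrite (_ : [set o | _] = \bigcap_m [set o | H (n + m)%N o `&` open_cone w !=set0]).
  apply: (@bigcapT_measurable _ (g_sigma_algebraType G)) => m.
  apply: (@measurable_meets _ (g_sigma_algebraType G)) => g.
  by apply: sub_sigma_algebra; exists (n + m)%N, g; rewrite leq_addr.
apply/seteqP; split => o /= ho m; first by move=> _; exact: ho.
have [h [Hh wh]] := ho m I; exists h; split => //.
by elim: n {G ho} Hh => // n ih; rewrite addSn => /Hdec /ih.
Qed.

(** * Semigroups generated by the positions of a walk *)

Section Walk.
Context {d : nat}.
Implicit Types x : nat -> Zd d.

Definition walk_semigroup (n : nat) x : set (Zd d) :=
  semigroup_gen [set \sum_(i < m) x i | m in [set m | (n <= m)%N]].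

Lemma semigroup_gen_subsemigroup (A : set (Zd d)) : is_subsemigroup (semigroup_gen A).
Proof.
by move=> a b Aa Ab S Ss AS; exact: Ss (Aa _ Ss AS) (Ab _ Ss AS).
Qed.

Lemma semigroup_gen_sub (A B : set (Zd d)) : A `<=` B -> semigroup_gen A `<=` semigroup_gen B.
Proof. by move=> AB g Ag S Ss BS; apply: Ag => //; exact: subset_trans BS. Qed.

Lemma walk_semigroup_leq m n x : (m <= n)%N -> walk_semigroup n x `<=` walk_semigroup m x.
Proof.
by move=> mn; apply: semigroup_gen_sub => _ [k nk <-]; exists k => //=; exact: leq_trans nk.
Qed.

(** Membership becomes a countable union over finite lists of times, which gives measurability. *)
Lemma walk_semigroupP n x g : walk_semigroup n x g <->
  exists ms : seq nat, [/\ ms != [::], all (leq n) ms & \sum_(m <- ms) \sum_(i < m) x i = g].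
Proof.
split.
  move=> /(_ [set g | exists ms : seq nat, [/\ ms != [::], all (leq n) ms &
    \sum_(m <- ms) \sum_(i < m) x i = g]]); apply.
    move=> a b [ms [ms0 nms <-]] [ns [ns0 nns <-]]; exists (ms ++ ns).
    by rewrite big_cat all_cat nms nns; split => //; case: ms ms0 {nms}.
  by move=> _ [m nm <-]; exists [:: m]; rewrite /= andbT big_seq1.
move=> [ms [+ + <-]] S Ss AS.
elim: ms => // m [|k ms] ih _ /=; rewrite big_cons.
  by rewrite big_nil addr0 andbT => nm; apply: AS; exists m.
move=> /andP[nm nms]; apply: Ss; first by apply: AS; exists m.
exact: ih.
Qed.

Lemma measurable_fiberD {dsp : measure_display} {T : measurableType dsp} (f h : T -> Zd d) :
  (forall g, measurable [set t | f t = g]) -> (forall g, measurable [set t | h t = g]) ->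
  forall g, measurable [set t | f t + h t = g].
Proof.
move=> mf mh g.
rewrite (_ : [set t | _] = \bigcup_a ([set t | f t = a] `&` [set t | h t = g - a])).
  by apply: countable_bigcupT_measurable => [|a]; [exact: countableP|exact: measurableI].
apply/seteqP; split => t /=.
  by move=> <-; exists (f t) => //; split => //=; rewrite addrC addKr.
by move=> [a _ [/= -> ->]]; rewrite addrC subrK.
Qed.

Lemma measurable_fiber_sum {dsp : measure_display} {T : measurableType dsp} (I : Type)
    (r : seq I) (f : I -> T -> Zd d) :
  (forall i g, measurable [set t | f i t = g]) ->
  forall g, measurable [set t | \sum_(i <- r) f i t = g].
Proof.
move=> mf; elim: r => [|i r ih] g.
  have [->|g0] := eqVneq g 0.
    by rewrite (_ : [set t | _] = setT)//; apply/seteqP; split => t // _; rewrite /= big_nil.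
  rewrite (_ : [set t | _] = set0)//; apply/seteqP; split => t //=.
  by rewrite big_nil => /esym/eqP; rewrite (negbTE g0).
rewrite (_ : [set t | _] = [set t | f i t + \sum_(i <- r) f i t = g]).
  exact: measurable_fiberD.
by apply/seteqP; split => t /=; rewrite big_cons.
Qed.

Lemma measurable_walk_semigroup n g :
  <<s cylinders >> [set x | walk_semigroup n x g].
Proof.
pose T := (g_sigma_algebraType (@cylinders d) : measurableType _).
rewrite (_ : [set x | _] = [set x : nat -> Zd d | [set ms : seq nat |
    \sum_(m <- ms) \sum_(i < m) x i = g] `&` [set ms | ms != [::] /\ all (leq n) ms] !=set0]).
  apply: (@measurable_meets _ T) => ms /=.
  apply: (@measurable_fiber_sum _ T) => m h.
  apply: (@measurable_fiber_sum _ T 'I_m _ (fun i (x : T) => x i)) => i a.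
  apply: sub_sigma_algebra; right; exists [:: nat_of_ord i], (fun=> a).
  apply/seteqP; split => x /=; first by move=> <- j; rewrite inE => /eqP ->.
  by apply; rewrite inE.
apply/seteqP; split => x /=.
  by move=> /walk_semigroupP[ms [? ? ?]]; exists ms.
by move=> [ms [? [? ?]]]; apply/walk_semigroupP; exists ms.
Qed.

Lemma walk_semigroup_meets_measurable n (U : set (Zd d)) :
  <<s cylinders >> [set x | walk_semigroup n x `&` U !=set0].
Proof.
apply: (@measurable_meets _ (g_sigma_algebraType (@cylinders d))) => g.
exact: measurable_walk_semigroup.
Qed.

Lemma walk_semigroup_opp n x g :
  walk_semigroup n (fun i => - x i) g -> walk_semigroup n x (- g).
Proof.
move=> /walk_semigroupP[ms [ms0 nms <-]]; apply/walk_semigroupP; exists ms; split => //.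
by rewrite -sumrN; apply: eq_bigr => m _; rewrite -sumrN; apply: eq_bigr => i _; rewrite opprK.
Qed.

(** For [m >= N] such an involution permutes the indices below [m], so the position at time [m] is
    unchanged. *)
Lemma walk_semigroup_reindex x f N : involutive f -> (forall i, (N <= i)%N -> f i = i) ->
  walk_semigroup N x `<=` walk_semigroup N (x \o f).
Proof.
move=> ff fN; apply: semigroup_gen_sub => _ [m Nm <-]; exists m => //=.
have fm i : (i < m)%N -> (f i < m)%N.
  move=> im; rewrite ltnNge; apply/negP => mfi.
  have := fN _ (leq_trans Nm mfi); rewrite ff => fi.
  by move: mfi; rewrite -fi leqNgt im.
pose F (i : 'I_m) : 'I_m := Ordinal (fm i (ltn_ord i)).
have FF : involutive F by move=> i; apply: val_inj; exact: ff.
by rewrite [RHS](reindex_inj (inv_inj FF)).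
Qed.

End Walk.

(** An increment after time [n] is the difference of two consecutive positions, both in the
    semigroup. *)
Lemma group_gen_walk_semigroup (d : nat) (A : set (Zd d)) (x : nat -> Zd d) n :
  group_gen A = setT -> (forall g, A g -> exists2 m, (n <= m)%N & x m = g) ->
  group_gen (walk_semigroup n x) = setT.
Proof.
move=> AT Ax; rewrite -subTset => g _ K Ksub KW.
have : group_gen A g by rewrite AT.
apply => // a /Ax[m nm <-]; have [_ [KD KN]] := Ksub.
have Km k : (n <= k)%N -> K (\sum_(i < k) x i).
  by move=> nk; apply: KW => S Ss; apply; exists k.
have -> : x m = \sum_(i < m.+1) x i + - \sum_(i < m) x i.
  by rewrite big_ord_recr /= addrAC subrr add0r.
by apply: KD; [apply: Km; exact: leqW|apply: KN; exact: Km].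
Qed.

(** The event of never seeing [g] from time [n] on is disjoint from every [C j], so
    [pairwise_indep_average] makes its probability times [mu g] vanish. *)
Lemma iid_hits_support {dsp : measure_display} {Omega : measurableType dsp} {R : realType}
    (P : probability Omega R) (d : nat) (mu : Zd d -> R) (zeta : Omega -> nat -> Zd d) n g :
  iid P mu zeta -> mu g != 0 -> {ae P, forall o, exists2 m, (n <= m)%N & zeta o m = g}.
Proof.
move=> iz mug.
pose C j := [set o | zeta o (n + j)%N = g].
have mC j : measurable (C j) by exact: iz.1.
pose A := ~` \bigcup_j C j.
have mA : measurable A by apply: measurableC; exact: bigcupT_measurable.
have PC j : P (C j) = (mu g)%:E.
  have := iz.2 [:: (n + j)%N] (fun=> g) isT; rewrite big_seq1 => <-; congr (P _).
  apply/seteqP; split => o /=; first by move=> oj i; rewrite inE => /eqP ->.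
  by apply; rewrite inE.
have PCC i j : i != j -> P (C i `&` C j) = (mu g * mu g)%:E.
  move=> ij; have := iz.2 [:: (n + i)%N; (n + j)%N] (fun=> g).
  rewrite big_cons big_seq1 /= inE eqn_add2l ij => /(_ isT) <-; congr (P _).
  apply/seteqP; split => o /=.
    by move=> [oi oj] k; rewrite !inE => /orP[] /eqP ->.
  by move=> h; split; apply: h; rewrite !inE eqxx ?orbT.
have AC j : P (A `&` C j) = 0%:E.
  rewrite (_ : A `&` C j = set0) ?measure0//.
  by apply/seteqP; split => o // [nA Cj]; apply: nA; exists j.
have /esym/eqP := pairwise_indep_average mA mC AC PC PCC.
rewrite mule_eq0 eqe (negbTE mug) orbF => /eqP PA0.
exists A; split => // o /= no [j _ Cj]; apply: no; exists (n + j)%N => //.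
exact: leq_addr.
Qed.

Lemma iid_walk_full {dsp : measure_display} {Omega : measurableType dsp} {R : realType}
    (P : probability Omega R) (d : nat) (mu : Zd d -> R) (zeta : Omega -> nat -> Zd d) :
  (0 < d)%N -> symmetric_measure mu -> group_gen (Defs.support mu) = setT -> iid P mu zeta ->
  {ae P, forall o, forall n, walk_semigroup n (zeta o) = setT}.
Proof.
move=> d0 mu_sym mu_gen iz.
apply: (@zero_one_semigroups_full _ _ _ _ _ (fun n o => walk_semigroup n (zeta o))) => //.
- split=> [n o|n g]; first exact: semigroup_gen_subsemigroup.
  exact: (iid_measurable iz (measurable_walk_semigroup n g)).
- by move=> n o; apply: walk_semigroup_leq; exact: leqnSn.
- have : {ae P, forall o, forall n g, Defs.support mu g -> exists2 m, (n <= m)%N & zeta o m = g}.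
    apply: ae_forall_countable => n; apply: ae_forall_countable => g.
    have [mug|nmug] := pselect (Defs.support mu g); last by apply: aeW => o /nmug.
    by have := iid_hits_support n iz mug; apply: filterS.
  by apply: filterS => o ho n; apply: group_gen_walk_semigroup mu_gen (ho n).
- move=> n w.
  rewrite -[LHS]/(P (zeta @^-1` [set x | walk_semigroup n x `&` open_cone w !=set0])).
  rewrite (iid_same_law iz (iid_opp mu_sym iz)); last exact: walk_semigroup_meets_measurable.
  congr (P _); apply/seteqP; split => o [h [Wh wh]]; exists (- h); split.
  + exact: walk_semigroup_opp.
  + by rewrite open_coneN opprK.
  + apply: walk_semigroup_opp; rewrite (_ : (fun i => _) = zeta o)//.
    by apply/funext => i; rewrite opprK.
  + by rewrite -open_coneN.
- move=> w.
  apply: (@hewitt_savage _ _ _ _ P mu zeta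
    [set x | forall n, walk_semigroup n x `&` open_cone w !=set0] iz).
    rewrite (_ : [set x | _] = \bigcap_n [set x | walk_semigroup n x `&` open_cone w !=set0]).
      apply: (@bigcapT_measurable _ (g_sigma_algebraType (@cylinders d))) => n.
      exact: walk_semigroup_meets_measurable.
    by apply/seteqP; split => [x hx n _|x hx n]; exact: hx.
  move=> f x ff [N fN] hx n.
  (* From time [maxn n N] on, the permutation [f] leaves the positions unchanged. *)
  have [h [Wh wh]] := hx (maxn n N); exists h; split => //.
  apply: (walk_semigroup_leq (leq_maxl n N)); apply: walk_semigroup_reindex Wh => // i.
  by rewrite geq_max => /andP[_]; exact: fN.
Qed.

Theorem mainTheorem5 (d : nat) (hd : (1 <= d)%N) :
  AR_group d /\
  (forall (dsp : measure_display) (Omega : measurableType dsp) (R : realType)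
          (P : probability Omega R) (H : nat -> Omega -> set 'rV[int]_d),
     random_subsemigroups H -> decreasing_semigroups H ->
     non_degenerate P H -> liouville P H -> symmetric_seq P H ->
     {ae P, forall w, forall n, H n w = [set: 'rV[int]_d]}).
Proof.
split; last by move=> dsp Omega R P H; exact: liouville_symmetric_full.
move=> R mu _ mu_sym mu_gen dsp Omega P zeta mz iz Pz n _.
have : iid P mu (fun o i => zeta i o).
  split=> [i g|s gs us]; first exact: mz.
  have -> : (fun o i => zeta i o) @^-1` cylinder s gs =
      \bigcap_(i in [set` s]) [set o | zeta i o = gs i].
    by apply/seteqP; split => o h i; exact: h.
  by rewrite iz// (eq_bigr _ (fun i _ => Pz i (gs i))) prodEFin.
move=> /(iid_walk_full hd mu_sym mu_gen); apply: filterS => o; exact.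
Qed.
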